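(* Let $C(z)=\sum_{n\ge 0}c_n z^n$, where $c_n$ is the number of nonnesting permutations of the multiset $\{1,1,2,2,\dots,n,n\}$ that avoid the pattern $123$ (with $c_0=1$). Let $V,U\in\mathbb{Q}[[z]]$ be the formal power series with constant term $1$ satisfying $V=1+zV^2$ and $U=1+3z+zU^2$. Then \[ C(z)=1+\frac{z(1+U)}{2-z(1+U)(1+V)} . \]
   Context: For $n\ge 0$, a nonnesting permutation of $\{1,1,2,2,\dots,n,n\}$ is a word $w=w_1w_2\cdots w_{2n}$ using each of the labels $1,\dots,n$ exactly twice such that there are no indices $i<j<k<\ell$ and labels $a\ne b$ with $w_i=w_\ell=a$ and $w_j=w_k=b$. The word $w$ avoids $123$ if there are no indices $i<j<k$ with $w_i<w_j<w_k$. The empty word is the unique such word for $n=0$. *)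

(* Defs.v *)
From HB Require Import structures.
From mathcomp Require Import all_boot all_order all_algebra.
From mathcomp Require Import boolp.

Set Implicit Arguments.
Unset Strict Implicit.
Unset Printing Implicit Defensive.

Import GRing.Theory.

Section Words.

(* The label a of {1, ..., n} is the ordinal of value a - 1 in 'I_n. *)
Variables (n : nat) (w : (2 * n).-tuple 'I_n).

Definition each_label_twice : bool := [forall a : 'I_n, count_mem a w == 2].

Definition nonnesting : bool :=
  ~~ [exists i : 'I_(2 * n), exists j : 'I_(2 * n), exists k : 'I_(2 * n),
      exists l : 'I_(2 * n), exists a : 'I_n, exists b : 'I_n,
      [&& i < j, j < k, k < l, a != b,
          tnth w i == a, tnth w l == a, tnth w j == b & tnth w k == b]].

Definition nonnesting_permutation : bool := each_label_twice && nonnesting.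

Definition avoids123 : bool :=
  ~~ [exists i : 'I_(2 * n), exists j : 'I_(2 * n), exists k : 'I_(2 * n),
      [&& i < j, j < k, tnth w i < tnth w j & tnth w j < tnth w k]].

End Words.

Definition num_avoiding123 (n : nat) : nat :=
  #|[set w : (2 * n).-tuple 'I_n | nonnesting_permutation w && avoids123 w]|.

Local Open Scope ring_scope.

Record fps (R : Type) := Fps { fps_coef : nat -> R }.

HB.instance Definition _ (R : Type) := [isNew for @fps_coef R].
HB.instance Definition _ (R : choiceType) := [Choice of fps R by <:].

Lemma fpsP (R : Type) (p q : fps R) : fps_coef p =1 fps_coef q -> p = q.
Proof. by case: p q => [p] [q] /= /funext ->. Qed.

Section FpsRing.

Variable R : comUnitRingType.
Implicit Types p q r : fps R.

Definition fps_zero : fps R := Fps (fun=> 0).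
Definition fps_opp p : fps R := Fps (fun n => - fps_coef p n).
Definition fps_add p q : fps R := Fps (fun n => fps_coef p n + fps_coef q n).

Fact fps_addA : associative fps_add.
Proof. by move=> p q r; apply: fpsP => n /=; rewrite addrA. Qed.
Fact fps_addC : commutative fps_add.
Proof. by move=> p q; apply: fpsP => n /=; rewrite addrC. Qed.
Fact fps_add0 : left_id fps_zero fps_add.
Proof. by move=> p; apply: fpsP => n /=; rewrite add0r. Qed.
Fact fps_addN : left_inverse fps_zero fps_opp fps_add.
Proof. by move=> p; apply: fpsP => n /=; rewrite addNr. Qed.

HB.instance Definition _ := GRing.isZmodule.Build (fps R)
  fps_addA fps_addC fps_add0 fps_addN.

Definition fps_one : fps R := Fps (fun n => (n == 0%N)%:R).
Definition fps_mul p q : fps R :=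
  Fps (fun n => \sum_(i < n.+1) fps_coef p i * fps_coef q (n - i)).

Definition fps_trunc N p : {poly R} := \poly_(i < N) fps_coef p i.

Lemma coef_fps_mul N p q n : (n < N)%N ->
  fps_coef (fps_mul p q) n = (fps_trunc N p * fps_trunc N q)`_n.
Proof.
move=> ltnN; rewrite coefM; apply: eq_bigr => i _; rewrite !coef_poly.
by rewrite (leq_ltn_trans (leq_ord i) ltnN) (leq_ltn_trans (leq_subr i n) ltnN).
Qed.

Fact fps_mulC : commutative fps_mul.
Proof.
by move=> p q; apply: fpsP => n; rewrite !(coef_fps_mul _ _ (ltnSn n)) mulrC.
Qed.
Fact fps_mulA : associative fps_mul.
Proof.
move=> p q r; apply: fpsP => n.
transitivity (fps_trunc n.+1 p * (fps_trunc n.+1 q * fps_trunc n.+1 r))`_n.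
  rewrite coefM; apply: eq_bigr => i _.
  by rewrite coef_poly ltn_ord -coef_fps_mul // ltnS leq_subr.
rewrite mulrA coefM; apply: eq_bigr => i _.
by rewrite coef_poly ltnS leq_subr -coef_fps_mul.
Qed.
Fact fps_mul1 : left_id fps_one fps_mul.
Proof.
move=> p; apply: fpsP => n /=.
rewrite big_ord_recl /= mul1r subn0 big1 ?addr0 // => i _.
by rewrite mul0r.
Qed.
Fact fps_mulDl : left_distributive fps_mul fps_add.
Proof.
move=> p q r; apply: fpsP => n /=; rewrite -big_split /=.
by apply: eq_bigr => i _; rewrite mulrDl.
Qed.
Fact fps_one_neq0 : fps_one != 0.
Proof.
by apply/eqP => /(congr1 (fun p => fps_coef p 0)) /eqP; rewrite /= oner_eq0.
Qed.

HB.instance Definition _ := GRing.Zmodule_isComNzRing.Build (fps R)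
  fps_mulA fps_mulC fps_mul1 fps_mulDl fps_one_neq0.

(* The first m coefficients of the inverse q of p, obtained by solving
   \sum_(i <= n) q_i p_(n - i) = (n == 0) for q_n, n = 0, 1, ..., m - 1. *)
Fixpoint fps_inv_seq p (m : nat) : seq R :=
  if m is n.+1 then
    let s := fps_inv_seq p n in
    rcons s ((fps_coef p 0)^-1 *
             ((n == 0%N)%:R - \sum_(i < n) s`_i * fps_coef p (n - i)))
  else [::].

Definition fps_unit : pred (fps R) :=
  fun p => fps_coef p 0 \is a GRing.unit.

(* Outside the units, inversion is the identity, as mathcomp requires. *)
Definition fps_inv p : fps R :=
  if fps_unit p then Fps (fun n => (fps_inv_seq p n.+1)`_n) else p.

Lemma size_fps_inv_seq p m : size (fps_inv_seq p m) = m.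
Proof. by elim: m => //= m IHm; rewrite size_rcons IHm. Qed.

Lemma nth_fps_inv_seq p m n : (n < m)%N ->
  (fps_inv_seq p m)`_n = (fps_inv_seq p n.+1)`_n.
Proof.
elim: m => // m IHm; rewrite ltnS leq_eqVlt => /predU1P[-> // | ltnm].
by rewrite [LHS]nth_rcons size_fps_inv_seq ltnm IHm.
Qed.

Fact fps_mulVr : {in fps_unit, left_inverse 1 fps_inv *%R}.
Proof.
move=> p up; apply: fpsP => n; rewrite /fps_inv ifT //=.
rewrite big_ord_recr /= subnn nth_rcons size_fps_inv_seq ltnn eqxx.
rewrite [_^-1 * _]mulrC mulrVK // addrC [X in _ + X](_ : _ =
  \sum_(i < n) (fps_inv_seq p n)`_i * fps_coef p (n - i)) ?subrK //.
by apply: eq_bigr => i _; rewrite (nth_fps_inv_seq p (ltn_ord i)).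
Qed.
Fact fps_unitPl p q : q * p = 1 -> fps_unit p.
Proof.
move=> /(congr1 (fun r => fps_coef r 0)) /=.
rewrite big_ord_recl big_ord0 addr0 /= => qp1.
by apply/unitrPr; exists (fps_coef q 0); rewrite mulrC.
Qed.
Fact fps_inv_out : {in [predC fps_unit], fps_inv =1 id}.
Proof. by move=> p; rewrite inE /fps_inv => /negPf up; rewrite ifF. Qed.

HB.instance Definition _ := GRing.ComNzRing_hasMulInverse.Build (fps R)
  fps_mulVr fps_unitPl fps_inv_out.

Definition fps_var : fps R := Fps (fun n => (n == 1%N)%:R).

End FpsRing.

Definition avoiding123_gf : fps rat := Fps (fun n => (num_avoiding123 n)%:R).

(* Main.v *)
Require Import Defs.
From HB Require Import structures.
From mathcomp Require Import all_boot all_order all_algebra.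
From mathcomp Require Import boolp zify ring.

Import GRing.Theory.

(* Read a word from right to left, so that 123 becomes 321 and words grow by
   cons.  A letter below the current maximum M must then be the least label
   still to come, and nonnesting says that the labels seen exactly once form a
   queue.  Hence the completions of a suffix only depend on the queue, on M and
   on the unseen labels below M (the gaps), and up to dead ends the queue is
   increasing with every gap above all its elements but the last, or it is
   [M; x] with x the least missing label.
   With T(g), B(g) the generating functions of the states with g gaps and queue
   [M], resp. [x] with x < M, and E(g) that of the empty queue, the recurrences
   have for g > 0 solutions proportional to L^g, where L = z + 3 z^2 + L^2,
   that is L = z U; longer queues are governed by powers of V. *)

(** * Generating functions of the states and their recurrences *)

Section Series.

Set Implicit Arguments.
Unset Strict Implicit.
Local Open Scope ring_scope.

Variables U V : fps rat.
Hypothesis hV : V = 1 + fps_var rat * V ^+ 2.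
Hypothesis hU : U = 1 + 3%:R * fps_var rat + fps_var rat * U ^+ 2.
Local Notation z := (fps_var rat).

Lemma coef_fpsD (p q : fps rat) k :
  fps_coef (p + q) k = fps_coef p k + fps_coef q k.
Proof. by []. Qed.

Lemma coef_fpsB (p q : fps rat) k :
  fps_coef (p - q) k = fps_coef p k - fps_coef q k.
Proof. by []. Qed.

Lemma coef_fps_var0 (p : fps rat) : fps_coef (z * p) 0 = 0.
Proof. by rewrite /= big_ord_recl big_ord0 /= mul0r addr0. Qed.

Lemma coef_fps_varS (p : fps rat) k : fps_coef (z * p) k.+1 = fps_coef p k.
Proof.
rewrite /= !big_ord_recl /= mul0r add0r mul1r subSS subn0 big1 ?addr0 // => i _.
by rewrite mul0r.
Qed.

Lemma coef_fps_varX (p : fps rat) d k : (k < d)%N -> fps_coef (z ^+ d * p) k = 0.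
Proof.
elim: d k => // d IHd [|k] ltkd; rewrite exprS -mulrA.
  exact: coef_fps_var0.
by rewrite coef_fps_varS IHd.
Qed.

(** Normalising factor of the solutions: the constant term 1 of [genE 0] fixes it through
    [genDE0]. *)
Definition genK : fps rat := (2%:R - z * (1 + U) * (1 + V))^-1.

(* [genD j g] counts, by number of unseen labels, the completions from an
   increasing queue of j + 1 labels ending in the maximum, with g gaps, all above
   the other j labels; [genS j g] is the sum of [genD j i] over i >= g.  [genB] and
   [genE] are B(g) and E(g) of the header. *)
Definition genS (j g : nat) : fps rat :=
  if g is g'.+1 then genK * (U - 1) * (z * U) ^+ g'
  else genK * (1 + U) * V ^+ j.

Definition genD (j g : nat) : fps rat := genS j g - genS j g.+1.

Definition genB (g : nat) : fps rat := 2%:R * genK * (z * U) ^+ g.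

Definition genE (g : nat) : fps rat :=
  z * genS 0 g + (if g is g'.+1 then z * genB g' else 1).

Lemma genK_mul : 2%:R * genK = 1 + z * (1 + U) * (1 + V) * genK.
Proof.
have uK : 2%:R - z * (1 + U) * (1 + V) \is a GRing.unit.
  (* Invertibility is decided by the constant coefficient, here 2. *)
  suff : fps_coef (2%:R - z * (1 + U) * (1 + V)) 0 \is a GRing.unit by [].
  by rewrite coef_fpsB -mulrA coef_fps_var0 subr0.
apply/eqP; rewrite -subr_eq -mulrBl; apply/eqP; exact: mulrV.
Qed.

(** Queue [M] without gaps: close M, or append a new maximum. *)
Lemma genDE0 : genD 0 0 = genE 0 + z * genS 1 0.
Proof.
rewrite /genD /genE /genS !expr0 expr1.
have := genK_mul; set K := genK => hK.
transitivity (2%:R * K); first by ring.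
by rewrite hK; ring.
Qed.

(** Queue [M] with a gap: close M, or open the least gap and then close M; a new maximum is a dead
    end. *)
Lemma genDES g : genD 0 g.+1 = genE g.+1 + z * genB g.
Proof.
have h0 : U - (1 + 3%:R * z + z * U ^+ 2) = 0 by rewrite -hU subrr.
apply: subr0_eq.
transitivity (genK * (z * U) ^+ g * (U - (1 + 3%:R * z + z * U ^+ 2))).
  by rewrite /genD /genE /genS /genB exprS; ring.
by rewrite h0 mulr0.
Qed.

(** Queue [x] with x < M: close x, or append a new maximum; the gaps lie above x and must wait. *)
Lemma genBE g : genB g = genE g + z * genS 1 g.
Proof.
case: g => [|g]; first by rewrite -genDE0 /genD /genB /genS !expr0; ring.
by rewrite /genE /genS /genB exprS; ring.
Qed.

(** Two or more queued labels, no gap: close the front, or append a new maximum. This is where the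
    equation of V enters. *)
Lemma genD0S j : genD j.+1 0 = genD j 0 + z * genS j.+2 0.
Proof.
have h0 : V - (1 + z * V ^+ 2) = 0 by rewrite -hV subrr.
apply: subr0_eq.
transitivity (genK * (1 + U) * V ^+ j * (V - (1 + z * V ^+ 2))).
  by rewrite /genD /genS !exprS; ring.
by rewrite h0 mulr0.
Qed.

(** With a gap, only closing the front is possible; [genS] ignores j at positive g. *)
Lemma genDSS j g : genD j.+1 g.+1 = genD j g.+1.
Proof. by []. Qed.

(** The equation of U gives U - 1 = z (3 + U^2), so [genS j g] is divisible by z^g. *)
Lemma coef_genS_gt j g t : (t < g)%N -> fps_coef (genS j g) t = 0.
Proof.
case: g => // g ltg.
have -> : genS j g.+1 = z ^+ g.+1 * (genK * (3%:R + U ^+ 2) * U ^+ g).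
  have h0 : U - (1 + 3%:R * z + z * U ^+ 2) = 0 by rewrite -hU subrr.
  apply: subr0_eq.
  transitivity (genK * (z * U) ^+ g * (U - (1 + 3%:R * z + z * U ^+ 2))).
    by rewrite /genS exprS exprMn; ring.
  by rewrite h0 mulr0.
exact: coef_fps_varX.
Qed.

(** Telescoping: the upper end [genS j t] has no coefficient at t - 1. *)
Lemma sum_coef_genD j g t : (g <= t)%N ->
  \sum_(g <= i < t) fps_coef (genD j i) t.-1 = fps_coef (z * genS j g) t.
Proof.
case: t => [|t] legt.
  by rewrite big_geq // coef_fps_var0.
rewrite coef_fps_varS.
rewrite (telescope_sumr_eq (fun i => - fps_coef (genS j i) t)) //.
  by rewrite coef_genS_gt // oppr0 add0r opprK.
by move=> i _; rewrite coef_fpsB opprK addrC.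
Qed.

End Series.

(** * The automaton on queues and gaps *)

Section Automaton.

Set Implicit Arguments.
Unset Strict Implicit.

Variable n : nat.

Definition closable (q g : seq nat) (m f : nat) : bool :=
  (f.+1 == m) || all (ltn f) (q ++ g).

(* Number of ways to append r letters, where q is the queue (most recently
   opened label first), g the increasing list of gaps, and m is 1 + the maximal
   label seen, or 0; the three summands append a new maximum, the least gap, and
   the second copy of the front of the queue. *)
Fixpoint runs (r : nat) (q g : seq nat) (m : nat) : nat :=
  if r is r'.+1 then
      \sum_(m <= x < n) runs r' (x :: q) (g ++ iota m (x - m)) x.+1
    + (if g is x :: g' then
         if all (ltn x) q then runs r' (x :: q) g' m else 0 else 0)
    + (if q is a :: q' then
         if closable (belast a q') g m (last a q')
         then runs r' (belast a q') g m else 0 else 0)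
  else [&& q == [::], g == [::] & m == n].

(* The label a cannot be closed before y, because y < a < m - 1, nor y before a,
   because of nonnesting. *)
Definition blocked (q g : seq nat) (m : nat) : Prop :=
  exists q1 a q2 y,
    [/\ q = q1 ++ a :: q2, y \in q1 ++ g, y < a & a.+1 < m].

(** Every letter keeps the state blocked, and a blocked queue is nonempty, so no run can end. *)
Lemma runs_blocked r q g m : blocked q g m -> runs r q g m = 0.
Proof.
elim: r q g m => [|r IHr] q g m [q1 [a [q2 [y [-> ygq ltya ltam]]]]] /=.
  by case: q1 {ygq}.
rewrite big_nat big1 => [|x /andP[lemx _]]; last first.
  apply: IHr; exists (x :: q1), a, q2, y; split=> //; last by lia.
  by move: ygq; rewrite inE !mem_cat => /orP[->|->]; rewrite ?orbT.
rewrite add0n; apply/eqP; rewrite addn_eq0; apply/andP; split; apply/eqP.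
  case: g ygq => // x g ygq; case: ifP => // _.
  apply: IHr; exists (x :: q1), a, q2, y; split=> //.
  by move: ygq; rewrite /= !(inE, mem_cat) orbCA.
(* If a is the front itself, y makes it not closable; otherwise an older front leaves and a, y
   stay. *)
case/lastP: q2 => [|q2 f].
  rewrite cats1; case E: (rcons q1 a) => [//|b q']; rewrite (lastI b q') in E.
  move: (rcons_inj E) => [<- <-]; rewrite /closable; case: ifP => // /orP[/eqP|]; first by lia.
  by move/allP => /(_ y ygq) /=; lia.
rewrite -rcons_cons -rcons_cat; case E: (rcons _ f) => [//|b q']; rewrite (lastI b q') in E.
have [<- <-] := rcons_inj E; case: ifP => // _.
by apply: IHr; exists q1, a, q2, y.
Qed.

Lemma runs_rcons r q f g m :
  runs r.+1 (rcons q f) g m =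
    \sum_(m <= x < n) runs r (x :: rcons q f) (g ++ iota m (x - m)) x.+1
    + (if g is x :: g' then
         if all (ltn x) (rcons q f) then runs r (x :: rcons q f) g' m else 0 else 0)
    + (if closable q g m f then runs r q g m else 0).
Proof.
rewrite [LHS]/=; congr addn; case E: (rcons q f) => [|b q'].
  by case: q E.
by rewrite (lastI b q') in E; have [<- <-] := rcons_inj E.
Qed.

(** * Counting the runs by the generating functions *)

Local Open Scope ring_scope.

Variables U V : fps rat.
Hypothesis hV : V = 1 + fps_var rat * V ^+ 2.
Hypothesis hU : U = 1 + 3%:R * fps_var rat + fps_var rat * U ^+ 2.
Local Notation z := (fps_var rat).

Definition unused (g : seq nat) (m : nat) : nat := size g + (n - m).

(** The strict bound on [y.+1] reflects that the maximum m - 1 has occurred and is not a gap. *)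
Definition lows (g : seq nat) (m : nat) : Prop :=
  [/\ (m <= n)%N, sorted ltn g & all (fun y => y.+1 < m)%N g].

Lemma lows_record g m x : lows g m -> (m <= x < n)%N ->
  lows (g ++ iota m (x - m)) x.+1.
Proof.
case=> lemn srt lt /andP[lemx ltxn]; split=> //.
  rewrite (sorted_pairwise ltn_trans) pairwise_cat -!(sorted_pairwise ltn_trans).
  rewrite srt iota_ltn_sorted !andbT; apply/allrelP => a b /(allP lt) /= ltam.
  by rewrite mem_iota; lia.
rewrite all_cat; apply/andP; split.
  by apply: sub_all lt => y /=; lia.
by apply/allP => y; rewrite mem_iota; lia.
Qed.

Lemma lows_behead x g m : lows (x :: g) m -> [/\ lows g m, all (ltn x) g & (x.+1 < m)%N].
Proof.
case=> lemn /= srt /andP[ltx lt]; split=> //; first by split=> //; exact: path_sorted srt.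
exact: order_path_min ltn_trans srt.
Qed.

(** A new maximum x adds x - m gaps, so the summands are consecutive terms of the telescoping
    sum. *)
Lemma sum_records q g m r j (t := unused g m) :
  lows g m ->
  (forall x, (m <= x < n)%N ->
    (runs r (x :: q) (g ++ iota m (x - m)) x.+1)%:R
    = fps_coef (genD U V j (size g + (x - m))) t.-1) ->
  (\sum_(m <= x < n) runs r (x :: q) (g ++ iota m (x - m)) x.+1)%:R
   = fps_coef (z * genS U V j (size g)) t.
Proof.
move=> [lemn _ _] Hx; rewrite -(sum_coef_genD V hU); last by rewrite /t /unused leq_addr.
rewrite natr_sum big_nat (eq_bigr _ Hx) -big_nat.
rewrite -{1}[m]add0n -{2}[size g]add0n !big_addn /t /unused addKn.
by apply: eq_bigr => i _; rewrite addnK addnC.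
Qed.

(** Here a may be the maximum itself: the new maximum makes the bound of [blocked] strict. *)
Lemma sum_records_blocked q g m r :
  (exists q1 a q2 y, [/\ q = q1 ++ a :: q2, y \in q1 ++ g, (y < a)%N & (a.+1 <= m)%N]) ->
  (\sum_(m <= x < n) runs r (x :: q) (g ++ iota m (x - m)) x.+1)%N = 0%N.
Proof.
case=> q1 [a [q2 [y [-> ygq ltya leam]]]].
rewrite big_nat big1 // => x /andP[lemx _]; apply: runs_blocked.
exists (x :: q1), a, q2, y; split=> //; last by lia.
by move: ygq; rewrite inE !mem_cat => /orP[->|->]; rewrite ?orbT.
Qed.

(** In these three claims r is forced: two copies of each unseen label and one of each queued label
    remain. *)
Definition count_empty r := forall g m,
  lows g m -> r = (unused g m).*2 ->
  (runs r [::] g m)%:R = fps_coef (genE U V (size g)) (unused g m).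

Definition count_low r := forall x g m, lows g m -> all (ltn x) g -> (x.+1 < m)%N ->
  r = (unused g m).*2.+1 ->
  (runs r [:: x] g m)%:R = fps_coef (genB U V (size g)) (unused g m).

Definition count_increasing r := forall M q g, lows g M.+1 ->
  sorted gtn (M :: q) -> all (fun a => all (ltn a) g) q ->
  r = ((unused g M.+1).*2 + (size q).+1)%N ->
  (runs r (M :: q) g M.+1)%:R = fps_coef (genD U V (size q) (size g)) (unused g M.+1).

Lemma unused_record g m x : (m <= x < n)%N ->
  unused (g ++ iota m (x - m)) x.+1 = (unused g m).-1.
Proof. by rewrite /unused size_cat size_iota; lia. Qed.

(** After a new maximum the queue is still increasing, and the added gaps, being at least m, lie
    above all of q. *)
Lemma records_count_increasing r q g m :
  lows g m -> count_increasing r -> (forall x, (m <= x < n)%N -> sorted gtn (x :: q)) ->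
  all (fun a => a < m)%N q ->
  all (fun a => all (ltn a) g) q ->
  r.+1 = ((unused g m).*2 + size q)%N ->
  (\sum_(m <= x < n) runs r (x :: q) (g ++ iota m (x - m)) x.+1)%:R
   = fps_coef (z * genS U V (size q) (size g)) (unused g m).
Proof.
move=> lg cD srt ltqm ltqg er; apply: sum_records => // x lex.
have er' : r = ((unused g m).-1.*2 + (size q).+1)%N.
  by move: er lex; rewrite /unused; lia.
rewrite cD ?unused_record //; first by rewrite size_cat size_iota.
- exact: lows_record.
- exact: srt.
apply/allP => a aq; rewrite all_cat (allP ltqg) //=; apply/allP => y.
by rewrite mem_iota; move: (allP ltqm a aq) => /=; lia.
Qed.

Lemma runs_count r : [/\ count_empty r, count_low r & count_increasing r].
Proof.
elim/ltn_ind: r => r IH; split.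
(* Empty queue: append a new maximum, or open the least gap if there is one. *)
- move=> g m lg er; case: r er IH => [|r] er IH.
    have -> : unused g m = 0%N by apply/eqP; rewrite -double_eq0 -er.
    case: g lg er => [|y g] [lemn _ _]; rewrite /unused => er; last by move: er => /=; lia.
    have -> : m = n by lia.
    by rewrite /runs !eqxx coef_fpsD coef_fps_var0 add0r.
  have [_ cB cD] := IH r (ltnSn r).
  rewrite [runs _ _ _ _]/= addn0 natrD (records_count_increasing (q := [::])) ?addn0 //.
  rewrite /genE coef_fpsD; congr (_ + _).
  case: g lg er => [|x g] lg er; first by case: (unused _ _) er.
  have [lg' ltx ltxm] := lows_behead lg.
  rewrite /= cB //; last by move: er; rewrite /unused /=; lia.
  by rewrite -coef_fps_varS.
(* Queue [x]: x is below all gaps, hence closable, and no gap can be opened before that. *)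
- move=> x g m lg ltxg ltxm er; case: r er IH => [//|r] [er] IH.
  rewrite (runs_rcons r [::]) !natrD (records_count_increasing (q := [:: x])) //.
  + rewrite genBE coef_fpsD addrC; congr (_ + _).
      rewrite ifT; last by rewrite /closable ltxg orbT.
      by have [cE _ _] := IH r (ltnSn r); rewrite cE //; lia.
    rewrite -[RHS]addr0; congr (_ + _).
    case: g lg ltxg {er} => // y g _ /andP[/= ltxy _].
    by rewrite ifF //; lia.
  + by case: (IH r).
  + by move=> y ley /=; lia.
  + by rewrite /= (ltnW ltxm).
  + by rewrite /= ltxg.
  + by move: er => /=; lia.
- move=> M q g lg; case/lastP: q => [|q f] srt ltqg er.
    (* Queue [M]: M is the maximum, so it can always be closed. *)
    case: r er IH => [|r] er IH; first by lia.
    have [cE _ cD] := IH r (ltnSn r).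
    have er' : r = (unused g M.+1).*2 by move: er => /=; lia.
    have clo : (runs r [::] g M.+1)%:R = fps_coef (genE U V (size g)) (unused g M.+1).
      by rewrite cE.
    rewrite (runs_rcons r [::]) !natrD /closable eqxx clo.
    case: g lg ltqg er er' clo => [|x g] lg ltqg er er' clo.
      rewrite (records_count_increasing (q := [:: M])) //.
      - by rewrite genDE0 coef_fpsD addr0 addrC.
      - by move=> x lex /=; lia.
      - by rewrite /= ltnSn.
    (* The gap x is below M and still to come, so a larger maximum would block M. *)
    have [lg' ltx ltxM] := lows_behead lg.
    rewrite sum_records_blocked; last first.
      by exists [::], M, [::], x; split; rewrite ?mem_head.
    rewrite add0r genDES // coef_fpsD addrC; congr (_ + _).
    have [-> ltxM' _] : [/\ all (ltn x) (rcons [::] M), x < M & True]%N.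
      by split=> //; rewrite /= andbT.
    have eu : (unused (x :: g) M.+1 = (unused g M.+1).+1)%N by [].
    case: r er IH {cE cD clo} er' => [|r] er IH er'; first by move: er'; rewrite eu.
    (* From the queue [:: x; M] the only way on is to close M. *)
    rewrite (runs_rcons r [:: x]) sum_records_blocked; last first.
      by exists [:: x], M, [::], x; split; rewrite ?mem_head.
    rewrite /closable eqxx add0n.
    have [_ cB _] := IH r (ltnW (ltnSn _)).
    rewrite [X in (X + _)%N](_ : _ = 0%N) ?add0n; last first.
      case: g lg ltqg er er' ltx {lg' eu} => // y g _ _ _ _ /andP[/= ltxy _].
      by rewrite ifF //; lia.
    rewrite eu coef_fps_varS cB //; last by move: er'; rewrite eu; lia.
  (* Longer queue: its front f is below all other queued labels and all gaps, so f can be closed and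
     no gap opened; a new maximum survives only without gaps. *)
  case: r er IH => [|r] er IH; first by lia.
  have [_ _ cD] := IH r (ltnSn r).
  have ltfq : all (ltn f) (M :: q).
    move: srt; rewrite -rcons_cons -cats1 (sorted_pairwise) ?pairwise_cat; last first.
      by move=> a b c /=; lia.
    by case/and3P=> /allrelP H _ _; apply/allP => a aq; apply: (H a f); rewrite ?mem_head.
  have ltfg : all (ltn f) g by apply: (allP ltqg); rewrite mem_rcons mem_head.
  rewrite (runs_rcons r (M :: q)) !natrD.
  rewrite [if closable _ _ _ _ then _ else _]ifT; last first.
    by rewrite /closable all_cat ltfq ltfg orbT.
  rewrite cD //.
  - case: g lg ltqg ltfg er => [|x g] lg ltqg ltfg er.
      rewrite (records_count_increasing (q := M :: rcons q f)) //.
      + by rewrite [size (M :: _)]/= size_rcons genD0S // coef_fpsD addr0 addrC.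
      + by move=> x lex; apply/andP; split; [move: lex => /=; lia | exact: srt].
      + rewrite /= ltnSn /=; apply/allP => a aq.
        move: srt => /= /(order_path_min (rev_trans ltn_trans)) /allP/(_ a aq) /=; lia.
    have [lg' ltx ltxM] := lows_behead lg.
    rewrite sum_records_blocked; last first.
      by exists [::], M, (rcons q f), x; split; rewrite ?mem_head.
    rewrite ifF ?size_rcons ?genDSS ?add0r //.
    apply/negbTE/negP => /allP /(_ f); rewrite mem_rcons mem_head => /(_ isT) /=.
    by move: ltfg => /= /andP[]; lia.
  - move: srt; rewrite -rcons_cons -cats1; exact: (subseq_sorted (rev_trans ltn_trans) (prefix_subseq _ _)).
  - by move: ltqg; rewrite all_rcons => /andP[].
  - by move: er; rewrite size_rcons; lia.
Qed.

Lemma runs_start : (runs n.*2 [::] [::] 0)%:R = fps_coef (genE U V 0) n.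
Proof.
have [cE _ _] := runs_count n.*2.
by rewrite cE /unused ?add0n ?subn0.
Qed.

End Automaton.

(** * Words and the suffixes that can still be completed *)

Section Words.

Set Implicit Arguments.
Unset Strict Implicit.

Variable n : nat.
Implicit Types s u w : seq nat.

Definition valid w : Prop :=
  [/\ forall x, x < n -> count_mem x w = 2,
      forall a b, a != b -> ~~ subseq [:: a; b; b; a] w
    & forall x y z, x < y -> y < z -> ~~ subseq [:: x; y; z] w].

(** Letters are put in front of s one at a time, so that this can be matched with [runs] step by
    step. *)
Fixpoint completions (r : nat) s : nat :=
  if r is r'.+1 then \sum_(0 <= x < n) completions r' (x :: s) else `[< valid s >].

Lemma completions_eq0 r s :
  (forall u, ~ valid (u ++ s)) -> completions r s = 0.
Proof.
elim: r s => [|r IHr] s inv /=.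
  by apply/eqP; rewrite eqb0; apply/asboolPn; exact: (inv [::]).
by rewrite big1 // => x _; apply: IHr => u; rewrite -cat_rcons; exact: inv.
Qed.

Lemma valid_remaining u s x : valid (u ++ s) -> x < n -> count_mem x s < 2 -> x \in u.
Proof.
case=> tw _ _ /tw; rewrite count_cat -has_pred1 has_count => + lt; lia.
Qed.

(** Source of the forbidden patterns: a label with a copy missing must still come in front of s. *)
Lemma valid_extend u s x p : valid (u ++ s) -> x < n -> count_mem x s < 2 ->
  subseq p s -> subseq (x :: p) (u ++ s).
Proof.
move=> val ltxn ltx sub; rewrite -cat1s; apply: cat_subseq => //.
by rewrite sub1seq (valid_remaining val).
Qed.

Lemma count_mem_cons x y s :
  count_mem y (x :: s) = (x == y) + count_mem y s.
Proof. by []. Qed.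

Lemma subseq_cons_cons a x p s :
  subseq (a :: p) (x :: s) = subseq (if a == x then p else a :: p) s.
Proof. by []. Qed.

(* The fields [live_ascent] and [live_square] say that no remaining letter
   creates a forbidden pattern when put in front of s. *)
Record live s : Prop := Live {
  live_lt : forall x, x \in s -> x < n;
  live_count : forall x, count_mem x s <= 2;
  live_ascent : forall x y z, y < z -> subseq [:: y; z] s ->
    x < n -> count_mem x s < 2 -> y <= x;
  live_avoid : forall x y z, x < y -> y < z -> ~~ subseq [:: x; y; z] s;
  live_square : forall a b, a != b -> subseq [:: b; b; a] s -> count_mem a s = 2;
  live_nonnesting : forall a b, a != b -> ~~ subseq [:: a; b; b; a] s }.

Lemma live_nil : live [::].
Proof. by split. Qed.

(** A new ascent x < z is harmless if no z exceeds x or no remaining label is below x; a new x x a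
    is harmless once a is used up. *)
Lemma live_cons s x : live s -> x < n -> count_mem x s < 2 ->
  (forall z, z \in s -> z <= x) \/
    (forall y, y < n -> count_mem y (x :: s) < 2 -> x <= y) ->
  (forall a, a != x -> subseq [:: x; a] s -> count_mem a s = 2) ->
  live (x :: s).
Proof.
move=> [lts cnt asc av sq nest] ltxn ltx rec front; split.
- by move=> y; rewrite inE => /predU1P[-> | /lts].
- by move=> y; rewrite count_mem_cons; have := cnt y; case: eqP => [<-|_]; lia.
- move=> y a b ltab; rewrite subseq_cons_cons.
  case: eqP => [ea | _] sub ltyn lty.
    case: rec => [rec|]; last by rewrite ea; exact.
    by rewrite ea in ltab *; move: sub; rewrite sub1seq => /rec; lia.
  by apply: (asc y a b) => //; move: lty; rewrite count_mem_cons; lia.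
- move=> a b c ltab ltbc; rewrite subseq_cons_cons.
  case: eqP => [ea | _]; last exact: av.
  rewrite ea in ltab.
  by apply/negP => /(asc x b c ltbc) /(_ ltxn ltx); lia.
- move=> a b neab; rewrite subseq_cons_cons.
  case: eqP => [eb | _] sub; last first.
    have ca := sq a b neab sub; rewrite count_mem_cons ca.
    by case: eqP ca ltx => [->|] //; lia.
  by rewrite count_mem_cons (front a) -?eb // eq_sym (negbTE neab).
- move=> a b neab; rewrite subseq_cons_cons.
  case: eqP => [ea | _]; last exact: nest.
  by apply/negP => /(sq a b neab); rewrite ea; lia.
Qed.

(** * Queue, gaps and bound of a suffix *)

Definition bound s : nat := \max_(x <- s) x.+1.
(** Words grow at the head, so the label opened first comes last. *)
Definition queue s : seq nat := [seq x <- s | count_mem x s == 1].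
Definition gaps s : seq nat := [seq x <- iota 0 (bound s) | x \notin s].

Lemma bound_cons x s : bound (x :: s) = maxn x.+1 (bound s).
Proof. by rewrite /bound big_cons. Qed.

Lemma mem_bound x s : x \in s -> x < bound s.
Proof. by move=> xs; rewrite /bound; exact: (@leq_bigmax_seq _ _ _ succn). Qed.

Lemma bound_leP b s : reflect (forall x, x \in s -> x < b) (bound s <= b).
Proof.
apply: (iffP idP) => [le x /mem_bound | lt]; first by lia.
by rewrite /bound; apply/bigmax_leqP_seq => x /lt.
Qed.

Lemma bound_gt b s : b < bound s -> exists2 z, z \in s & b <= z.
Proof.
move=> lt; apply/hasP; apply/negPn/negP => /hasPn no.
by have /bound_leP : forall x, x \in s -> x < b by [move=> x /no /=; lia]; lia.
Qed.

Lemma mem_queue s x : (x \in queue s) = (count_mem x s == 1).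
Proof.
rewrite mem_filter; case: eqP => //= c1.
by rewrite -has_pred1 has_count c1.
Qed.

Lemma mem_gaps s x : (x \in gaps s) = (x < bound s) && (x \notin s).
Proof. by rewrite mem_filter mem_iota andbC. Qed.

Lemma queue_open s x : x \notin s -> queue (x :: s) = x :: queue s.
Proof.
move=> xs; have c0 := count_memPn xs; rewrite /queue /= eqxx c0; congr cons.
apply: eq_in_filter => y ys; rewrite (_ : (x == y) = false) //.
by apply: contraNF xs => /eqP ->.
Qed.

Lemma queue_subseq s : subseq (queue s) s.
Proof. exact: filter_subseq. Qed.

Lemma queue_uniq s : uniq (queue s).
Proof.
apply: count_mem_uniq => x; rewrite mem_queue count_filter.
case: eqP => c; last first.
  by apply/eqP; rewrite -leqn0 leqNgt -has_count; apply/hasPn => y _ /=;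
     apply/negP => /andP[/eqP -> /eqP].
rewrite -[RHS]c; apply: eq_in_count => y _ /=.
by case: eqP => // ->; rewrite c.
Qed.

Lemma queue_close s q f : queue s = rcons q f -> queue (f :: s) = q.
Proof.
move=> eq; have : f \in queue s by rewrite eq mem_rcons mem_head.
rewrite mem_queue => /eqP c1.
have uq := queue_uniq s.
rewrite (_ : queue (f :: s) = [seq y <- queue s | y != f]).
  rewrite eq filter_rcons eqxx /=; apply/all_filterP/allP => y yq.
  by move: uq; rewrite eq rcons_uniq => /andP[+ _]; apply: contraNneq => <-.
rewrite -filter_predI /queue -[LHS]/(if count_mem f (f :: s) == 1 then _ else _).
rewrite (_ : count_mem f (f :: s) = 2) ?count_mem_cons ?eqxx ?c1 //.
apply: eq_in_filter => y ys.
change (((f == y) + count_mem y s == 1) = (y != f) && (count_mem y s == 1)).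
by case: (eqVneq f y) => [<- | //]; rewrite c1.
Qed.

Lemma bound_close s x : x < bound s -> bound (x :: s) = bound s.
Proof. by rewrite bound_cons; lia. Qed.

Lemma gaps_close s x : x \in s -> gaps (x :: s) = gaps s.
Proof.
move=> xs; rewrite /gaps bound_close ?mem_bound //; apply: eq_filter => y.
by rewrite inE negb_or; case: eqP => // ->; rewrite xs.
Qed.

Lemma gaps_low s x g : gaps s = x :: g -> gaps (x :: s) = g.
Proof.
move=> eg; have : x \in gaps s by rewrite eg mem_head.
rewrite mem_gaps => /andP[ltx xs].
have : uniq (gaps s) by rewrite filter_uniq ?iota_uniq.
rewrite eg => /= /andP[xg _].
rewrite /gaps bound_close //.
rewrite (_ : filter _ _ = [seq y <- gaps s | y != x]).
  rewrite eg /= eqxx /=; apply/all_filterP/allP => y yg.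
  by apply: contraNneq xg => <-.
by rewrite -filter_predI; apply: eq_filter => y; rewrite /= inE negb_or.
Qed.

Lemma gaps_record s x : bound s <= x -> gaps (x :: s) = gaps s ++ iota (bound s) (x - bound s).
Proof.
move=> lex; rewrite /gaps bound_cons (maxn_idPl _); last by lia.
(* Three ranges: the old gaps, the labels skipped by x, and x itself. *)
have -> : x.+1 = bound s + (x - bound s) + 1 by lia.
rewrite !iotaD !filter_cat !add0n subnKC //= inE eqxx cats0; congr (_ ++ _).
  apply: eq_in_filter => y; rewrite mem_iota inE negb_or => /= lty.
  by have -> : y != x by lia.
apply/all_filterP/allP => y; rewrite mem_iota inE negb_or => lty.
apply/andP; split; first by lia.
by apply/negP => /mem_bound; lia.
Qed.

(** * Which letters can extend a suffix *)

Lemma completions_used r s x : x < n -> count_mem x s = 2 -> completions r (x :: s) = 0.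
Proof.
move=> ltxn c2; apply: completions_eq0 => u [/(_ x ltxn) + _ _].
by rewrite count_cat count_mem_cons eqxx c2; lia.
Qed.

(** Some larger z follows x, and y must still come before x, so y x z is a 123. *)
Lemma completions_not_min r s x y : x < n -> y < n -> y < x ->
  count_mem y (x :: s) < 2 -> x.+1 < bound s -> completions r (x :: s) = 0.
Proof.
move=> ltxn ltyn ltyx cy /bound_gt [z zs ltxz]; apply: completions_eq0 => u val.
have sub : subseq [:: x; z] (x :: s) by rewrite subseq_cons_cons eqxx sub1seq.
have := valid_extend val ltyn cy sub; apply/negP.
by case: val => _ _ av; exact: av.
Qed.

Lemma subseq_last (q : seq nat) f x : x \in q -> subseq [:: x; f] (rcons q f).
Proof.
by move=> xq; rewrite -cats1; apply: (@cat_subseq _ [:: x] [:: f]); rewrite sub1seq ?mem_head.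
Qed.

(** Closing x while the older f is open gives x x f, and the second f will complete f x x f. *)
Lemma completions_not_front r s q f x : f < n -> queue s = rcons q f ->
  x \in queue s -> x != f -> completions r (x :: s) = 0.
Proof.
move=> ltfn eq xq nexf; apply: completions_eq0 => u val.
have sub : subseq [:: x; f] s.
  apply: subseq_trans (queue_subseq s).
  by rewrite eq; apply: subseq_last; move: xq; rewrite eq mem_rcons inE (negbTE nexf).
have sub' : subseq [:: x; x; f] (x :: s) by rewrite subseq_cons_cons eqxx.
have cf : count_mem f (x :: s) < 2.
  have : f \in queue s by rewrite eq mem_rcons mem_head.
  by rewrite mem_queue count_mem_cons (negbTE nexf) => /eqP ->.
have := valid_extend val ltfn cf sub'; apply/negP.
by case: val => _ nest _; apply: nest; rewrite eq_sym.
Qed.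

(** A label a behind f with a single copy would be queued behind f, but f is last. *)
Lemma live_front s q f a : live s -> queue s = rcons q f -> a != f ->
  subseq [:: f; a] s -> count_mem a s = 2.
Proof.
move=> ls eq neaf sub.
have sa : a \in s by apply: (mem_subseq sub); rewrite !inE eqxx orbT.
have : 0 < count_mem a s by rewrite -has_count has_pred1.
have := live_count ls a.
case: (count_mem a s =P 1) => [ca|]; last by lia.
have qf : f \in queue s by rewrite eq mem_rcons mem_head.
have : subseq [:: f; a] (queue s).
  by rewrite subseq_filter sub /= -!mem_queue qf mem_queue ca.
have := queue_uniq s; rewrite eq rcons_uniq => /andP[/negP fq _].
rewrite -subseq_rev rev_rcons -[rev [:: f; a]]/[:: a; f] subseq_cons_cons.
rewrite (negbTE neaf) => /mem_subseq /(_ f).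
by rewrite !inE eqxx orbT mem_rev => /(_ isT).
Qed.

Lemma sum_eq_mul b k c : \sum_(0 <= x < b) (x == k) * c = (k < b) * c.
Proof.
elim: b => [|b IHb]; first by rewrite big_geq.
rewrite big_nat_recr //= IHb -mulnDl; congr (_ * _).
by case: ltngtP => //=; lia.
Qed.

(** Below the maximum or equal to it, only the least gap and the front of the queue are possible.
    The default [n] of [head] and [last] differs from x, as x < [bound s] <= n. *)
Lemma completions_low r s x (ls : live s) :
  (forall s', live s' -> completions r s' = runs n r (queue s') (gaps s') (bound s')) ->
  x < bound s -> bound s <= n ->
  completions r (x :: s) =
    (x == head n (gaps s)) *
      (if gaps s is y :: g then
         if all (ltn y) (queue s) then runs n r (y :: queue s) g (bound s) else 0 else 0)
  + (x == last n (queue s)) *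
      (if queue s is a :: q then
         if closable (belast a q) (gaps s) (bound s) (last a q)
         then runs n r (belast a q) (gaps s) (bound s) else 0 else 0).
Proof.
move=> IH ltx lebn; have ltxn : x < n by lia.
have rem_lt y : y \in queue s ++ gaps s -> y < n /\ count_mem y s < 2.
  rewrite mem_cat mem_queue mem_gaps => /orP[/eqP c1 | /andP[lty /count_memPn ->]].
    by rewrite c1; split=> //; apply: (live_lt ls); rewrite -has_pred1 has_count c1.
  by split=> //; exact: leq_trans lebn.
have rem_in y : y < n -> count_mem y s < 2 -> y \in queue s ++ gaps s \/ bound s <= y.
  move=> ltyn cy; rewrite mem_cat mem_queue mem_gaps -has_pred1 has_count.
  by case: (leqP (bound s) y); [right | left; lia].
have not_head : x \notin gaps s -> x == head n (gaps s) = false.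
  by case: (gaps s) => [_|y g] /=; [rewrite ltn_eqF | rewrite inE negb_or => /andP[/negbTE]].
have not_last : x \notin queue s -> x == last n (queue s) = false.
  case: (queue s) => [|a q] /= xq; first by rewrite ltn_eqF.
  by apply: contraNF xq => /eqP ->; exact: mem_last.
(* A queued x must be the front, otherwise nesting occurs. *)
case: (boolP (x \in queue s)) => [xq | xq].
  have xs : x \in s := mem_subseq (queue_subseq s) xq.
  rewrite not_head ?mem_gaps ?xs ?andbF // mul0n add0n.
  have c1 : count_mem x s = 1 by apply/eqP; rewrite -mem_queue.
  case E: (queue s) => [|a q]; first by rewrite E in xq.
  have eq : queue s = rcons (belast a q) (last a q) by rewrite -lastI.
  rewrite [last n _]/=; case: (eqVneq x (last a q)) => [ex | nex]; last first.
    rewrite mul0n; apply: (@completions_not_front r s _ _ x _ eq) => //.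
    by have [] := rem_lt (last a q); rewrite // E mem_cat mem_last.
  rewrite -ex in eq *; rewrite mul1n.
  have rest y : y \in belast a q ++ gaps s -> y != x.
    apply: contraTneq => ->; rewrite mem_cat mem_gaps xs andbF orbF.
    by have := queue_uniq s; rewrite eq rcons_uniq => /andP[].
  case: ifP => clo.
    rewrite IH ?(queue_close eq) ?gaps_close ?bound_close //.
    apply: live_cons => //; first by rewrite c1.
      case/orP: clo => [/eqP ex1 | /allP min].
        by left => z /mem_bound; lia.
      right => y ltyn; rewrite count_mem_cons => cy.
      have [||] := rem_in y ltyn; [by lia | | by lia].
      rewrite eq mem_cat mem_rcons inE -orbA -mem_cat => /predU1P[-> // | /min /=].
      exact: ltnW.
    by move=> b nebx; apply: live_front eq nebx.
  (* Some remaining y is below x, and x is below the maximum: y will complete a 123. *)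
  move: clo => /negbT; rewrite negb_or => /andP[nex /allPn[y yr ley]].
  have [ltyn cy] : y < n /\ count_mem y s < 2.
    by apply: rem_lt; move: yr; rewrite eq !mem_cat mem_rcons inE -orbA => ->; rewrite orbT.
  have neyx := rest y yr.
  apply: (@completions_not_min _ _ _ y) => //.
  - by move: ley neyx => /=; lia.
  - by rewrite count_mem_cons eq_sym (negbTE neyx).
  - by move: nex; lia.
rewrite not_last // mul0n addn0.
case: (boolP (x \in gaps s)) => [xg | xg]; last first.
  (* Neither queued nor a gap, x already has both copies. *)
  rewrite not_head // mul0n; apply: completions_used => //.
  move: xg xq; rewrite mem_gaps ltx negbK mem_queue -has_pred1 has_count.
  by have := live_count ls x; lia.
have xs : x \notin s by move: xg; rewrite mem_gaps => /andP[].
have c0 := count_memPn xs.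
(* The maximum occurs in s and x does not, so x is strictly below it. *)
have ltSx : x.+1 < bound s.
  have [z zs lexz] := bound_gt ltx; have := mem_bound zs.
  by case: (eqVneq x z) xs => [->|]; [rewrite zs | lia].
have not_min y : y \in queue s ++ gaps s -> y < x -> completions r (x :: s) = 0.
  move=> /rem_lt[ltyn cy] ltyx; apply: (@completions_not_min _ _ _ y) => //.
  by rewrite count_mem_cons; lia.
have srt : sorted ltn (gaps s).
  by apply: sorted_filter; [exact: ltn_trans | exact: iota_ltn_sorted].
case E: (gaps s) => [|y g]; first by rewrite E in xg.
have /allP ltyg : all (ltn y) g by move: srt; rewrite E; exact: order_path_min ltn_trans.
rewrite [head _ _]/=; case: (eqVneq x y) => [exy | nexy]; last first.
  rewrite mul0n; apply: (not_min y); first by rewrite E mem_cat mem_head orbT.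
  by move: xg; rewrite E inE (negbTE nexy) => /ltyg.
rewrite mul1n -exy; case: ifP => [/allP ltxq | /negbT/allPn[w wq lew]]; last first.
  apply: (not_min w); first by rewrite mem_cat wq.
  by move: lew xq; case: (eqVneq w x) => [<-|]; [rewrite wq | move=> /=; lia].
rewrite IH ?queue_open // ?bound_close // ?(gaps_low (g := g)) ?exy //.
apply: live_cons; rewrite -?exy ?c0 //; last first.
  by move=> a _ /mem_subseq /(_ x); rewrite mem_head => /(_ isT); rewrite (negbTE xs).
right => w ltwn; rewrite count_mem_cons => cw.
have [||] := rem_in w ltwn; [by lia | | by lia].
rewrite mem_cat E -exy inE => /or3P[/ltxq /ltnW // | /eqP -> // | /ltyg].
by rewrite -exy => /ltnW.
Qed.

Lemma completions_runs r s : live s ->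
  completions r s = runs n r (queue s) (gaps s) (bound s).
Proof.
elim: r s => [|r IHr] s ls.
  (* No letter left: a live word is valid exactly when every label below n occurs twice, that is,
     nothing is queued, no gap remains and the bound is n. *)
  rewrite /=; congr nat_of_bool; apply/asboolP/and3P => [[tw _ _]|[/eqP q0 /eqP g0 /eqP bn]].
    have in_s x : x < n -> x \in s.
      by move=> /tw c; rewrite -has_pred1 has_count c.
    have bn : bound s = n.
      apply/eqP; rewrite eqn_leq; apply/andP; split.
        by apply/bound_leP; exact: live_lt.
      by case: n in_s => // k in_s; apply: mem_bound; exact: in_s.
    split; last by rewrite bn.
      apply/eqP/nilP; rewrite /nilp -leqn0 leqNgt -has_predT; apply/hasPn => x.
      by rewrite mem_queue => /eqP c1; 
        have := tw x; rewrite c1 => /(_ (live_lt ls _)); rewrite -has_pred1 has_count c1 => /(_ isT).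
    apply/eqP/nilP; rewrite /nilp -leqn0 leqNgt -has_predT; apply/hasPn => x.
    by rewrite mem_gaps bn => /andP[/in_s ->].
  split; last first.
  - exact: live_avoid.
  - exact: live_nonnesting.
  - move=> x ltxn; have : x \notin queue s by rewrite q0.
    have : x \notin gaps s by rewrite g0.
    rewrite mem_gaps bn ltxn negbK mem_queue -has_pred1 has_count.
    by have := live_count ls x; lia.
have lebn : bound s <= n by apply/bound_leP; exact: live_lt.
(* Letters from [bound s] on are new maxima; below it the sum reduces to two indicator terms. *)
rewrite [LHS]/= (big_cat_nat (leq0n (bound s)) lebn) /= [X in X + _ = _]big_nat.
rewrite (eq_bigr _ (fun x ltx => completions_low ls IHr ltx lebn)).
rewrite -big_nat big_split /= !sum_eq_mul addnC -addnA; congr (_ + (_ + _)).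
- rewrite big_nat [RHS]big_nat; apply: eq_bigr => x /andP[lex ltx].
  have xs : x \notin s by apply/negP => /mem_bound; lia.
  rewrite IHr ?queue_open ?gaps_record // ?bound_cons; first by congr runs; lia.
  have c0 := count_memPn xs.
  apply: live_cons => //; first by rewrite c0.
    by left => y /mem_bound; lia.
  move=> a _ /mem_subseq /(_ x); rewrite mem_head => /(_ isT).
  by rewrite (negbTE xs).
- case E: (gaps s) => [|y g]; first by rewrite muln0.
  by have := mem_gaps s y; rewrite E mem_head /= => /esym/andP[-> _]; rewrite mul1n.
- case E: (queue s) => [|a q]; first by rewrite muln0.
  rewrite (_ : _ < _) ?mul1n // mem_bound //=; apply: (mem_subseq (queue_subseq s)).
  by rewrite E mem_last.
Qed.

End Words.

(** * From tuples of ordinals to words of natural numbers *)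

Section Link.

Set Implicit Arguments.
Unset Strict Implicit.

(** Turns the index quantifiers of [avoids123] and [nonnesting] into subsequences. *)
Lemma subseq_nthP (T : eqType) (x0 : T) (u s : seq T) :
  reflect (exists2 l, sorted ltn l && all (gtn (size s)) l & u = [seq nth x0 s i | i <- l])
          (subseq u s).
Proof.
apply: (iffP idP) => [/subseqP[m sm ->] | [l /andP[srt lt] ->]].
  exists (mask m (iota 0 (size s))); last by rewrite map_mask map_nth_iota0 // take_size.
  rewrite (subseq_sorted ltn_trans (mask_subseq _ _)) ?iota_ltn_sorted //=.
  by apply/allP => i /mem_mask; rewrite mem_iota.
rewrite -[X in subseq _ X](take_size s) -(map_nth_iota0 x0) //; apply: map_subseq.
(* A strictly increasing list of indices is a filtered initial range. *)
rewrite (_ : l = [seq i <- iota 0 (size s) | i \in l]) ?filter_subseq //.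
apply: (irr_sorted_eq ltn_trans ltnn) => //.
  by apply: sorted_filter; [exact: ltn_trans | exact: iota_ltn_sorted].
move=> i; rewrite mem_filter mem_iota /=; case: (boolP (i \in l)) => // /(allP lt) /= ->.
by [].
Qed.

Variable n : nat.

Lemma nth_val (w : (2 * n).-tuple 'I_n) (i : 'I_(2 * n)) :
  nth 0 [seq val x | x <- w] i = tnth w i.
Proof.
have i0 : 'I_n by exact: tnth w i.
by rewrite (nth_map i0) ?size_tuple // -tnth_nth.
Qed.

Lemma avoids123P (w : (2 * n).-tuple 'I_n) :
  reflect (forall x y z, x < y -> y < z -> ~~ subseq [:: x; y; z] [seq val a | a <- w])
          (avoids123 w).
Proof.
apply: (iffP negP) => [no x y z ltxy ltyz | av /existsP[i /existsP[j /existsP[k]]]].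
  apply/negP => /(subseq_nthP 0)[[|i [|j [|k [|//]]]] //]; rewrite size_map size_tuple /= !andbT.
  case/andP=> /andP[ltij ltjk] /and3P[lti ltj ltk] [ex ey ez]; apply: no.
  apply/existsP; exists (Ordinal lti); apply/existsP; exists (Ordinal ltj).
  apply/existsP; exists (Ordinal ltk); rewrite -!nth_val /= ltij ltjk.
  by rewrite -ex -ey -ez ltxy ltyz.
case/and4P=> ltij ltjk ltx lty; apply/negP: (av _ _ _ ltx lty); apply/negPn.
apply/(subseq_nthP 0); exists [:: val i; val j; val k]; last by rewrite /= !nth_val.
by rewrite size_map size_tuple /= ltij ltjk !ltn_ord.
Qed.

Lemma nonnestingP (w : (2 * n).-tuple 'I_n) :
  reflect (forall a b, a != b -> ~~ subseq [:: a; b; b; a] [seq val a | a <- w])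
          (nonnesting w).
Proof.
apply: (iffP negP) => [no a b neab |
    nest /existsP[i /existsP[j /existsP[k /existsP[l /existsP[a /existsP[b]]]]]]].
  apply/negP => /(subseq_nthP 0)[[|i [|j [|k [|l [|//]]]]] //].
  rewrite size_map size_tuple /= !andbT.
  case/andP=> /and3P[ltij ltjk ltkl] /and4P[lti ltj ltk ltl] [ex ey ey' ex']; apply: no.
  apply/existsP; exists (Ordinal lti); apply/existsP; exists (Ordinal ltj).
  apply/existsP; exists (Ordinal ltk); apply/existsP; exists (Ordinal ltl).
  apply/existsP; exists (tnth w (Ordinal lti)).
  apply/existsP; exists (tnth w (Ordinal ltj)).
  rewrite -!(inj_eq val_inj) /= -!nth_val /= -ex -ey -ex' -ey' neab !eqxx.
  by rewrite ltij ltjk ltkl.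
case/and4P=> ltij ltjk ltkl /and5P[neab /eqP eia /eqP ela /eqP ejb /eqP ekb].
have neab' : val a != val b by rewrite (inj_eq val_inj).
apply/negP: (nest _ _ neab'); apply/negPn.
apply/(subseq_nthP 0); exists [:: val i; val j; val k; val l].
  by rewrite size_map size_tuple /= ltij ltjk ltkl !ltn_ord.
by rewrite /= !nth_val eia ejb ekb ela.
Qed.

(** The tuple lists the letters in the order in which they are put in front of s, hence [catrev]. *)
Lemma completions_card r s :
  completions n r s =
    #|[set t : r.-tuple 'I_n | `[< valid n (catrev [seq val x | x <- t] s) >]]|.
Proof.
elim: r s => [|r IHr] s /=.
  rewrite (_ : finset _ = if `[< valid n s >] then setT else set0); last first.
    by apply/setP => t; rewrite inE tuple0 /=; case: ifP; rewrite inE.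
  by case: ifP; rewrite ?cards0 // cardsT card_tuple.
rewrite big_mkord (eq_bigr _ (fun x _ => IHr _)).
rewrite -sum1_card (reindex (fun p : 'I_n * r.-tuple 'I_n => cons_tuple p.1 p.2)) /=.
  under eq_bigr do rewrite -sum1_card.
  rewrite pair_big_dep /=; apply: eq_bigl => -[x t]; rewrite !inE //.
exists (fun t => (thead t, behead_tuple t)) => [[x t] _ | t _] /=.
  by congr (_, _); apply: val_inj.
by rewrite [RHS]tuple_eta.
Qed.

Lemma validP (w : (2 * n).-tuple 'I_n) :
  reflect (valid n [seq val x | x <- w]) (nonnesting_permutation w && avoids123 w).
Proof.
have cnt (a : 'I_n) : count_mem (val a) [seq val x | x <- w] = count_mem a w.
  by rewrite count_map; apply: eq_count => x /=; rewrite (inj_eq val_inj).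
apply: (iffP andP) => [[/andP[/forallP tw /nonnestingP nest] /avoids123P av] | [tw nest av]].
  by split=> // x ltxn; rewrite (cnt (Ordinal ltxn)); apply/eqP; exact: tw.
split; last exact/avoids123P.
by apply/andP; split; [apply/forallP => a; rewrite -cnt tw // ltn_ord | exact/nonnestingP].
Qed.

(** Completions spell a word from its right end, so tuples are matched through the bijection
    [rev]. *)
Lemma num_avoiding123E : num_avoiding123 n = completions n (2 * n) [::].
Proof.
pose f (t : (2 * n).-tuple 'I_n) := [tuple of rev t].
have injf : injective f by move=> t u /(congr1 val) /(can_inj revK) /val_inj.
rewrite completions_card /num_avoiding123 -(card_preimset _ injf).
apply: eq_card => t; rewrite !inE.
by apply/validP/asboolP; rewrite catrevE cats0 map_rev.
Qed.

Lemma num_avoiding123_coef (U V : fps rat) :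
  V = (1 + fps_var rat * V ^+ 2)%R ->
  U = (1 + 3%:R * fps_var rat + fps_var rat * U ^+ 2)%R ->
  ((num_avoiding123 n)%:R = fps_coef (genE U V 0) n)%R.
Proof.
move=> hV hU; rewrite num_avoiding123E completions_runs; last exact: live_nil.
by rewrite mul2n /queue /gaps /bound big_nil (runs_start n hV hU).
Qed.

End Link.

(** * The closed form *)

Local Open Scope ring_scope.

Theorem theorem1p1 (V U : fps rat)
    (hV0 : fps_coef V 0 = 1) (hV : V = 1 + fps_var rat * V ^+ 2)
    (hU0 : fps_coef U 0 = 1)
    (hU : U = 1 + 3%:R * fps_var rat + fps_var rat * U ^+ 2) :
  avoiding123_gf =
    1 + (fps_var rat * (1 + U))
        / (2%:R - fps_var rat * (1 + U) * (1 + V)).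
Proof.
(* The empty suffix has empty queue, no gaps and bound 0, so [genE] at 0 counts all the words. *)
have -> : avoiding123_gf = genE U V 0.
  by apply: fpsP => n; exact: num_avoiding123_coef.
by rewrite /genE /genS /genK expr0; ring.
Qed.
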